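(* Let $X$ be a real Banach space, let $u\in X$, and let $f:X\to\mathbb{R}$ and $g:\mathbb{R}\to\mathbb{R}$ be functions. Suppose that $f$ is Lipschitz in a neighborhood of $u$ and that $g$ is strictly differentiable near $f(u)$ (i.e. at every point of some neighborhood of $f(u)$). Then $F=g\circ f$ is Lipschitz in a neighborhood of $u$, and $$\partial F(u)\subset g'(f(u))\,\partial f(u),$$ that is, every $z\in\partial F(u)$ can be represented as $\langle z,v\rangle=g'(f(u))\langle\xi,v\rangle$ for all $v\in X$, for some $\xi\in\partial f(u)$.
   Context: For a functional $I:X\to\mathbb{R}$ that is Lipschitz in a neighborhood of $u\in X$, the generalized directional derivative at $u$ in the direction $v\in X$ is $$I^0(u;v)=\limsup_{h\to0,\ \lambda\to0^+}\frac{I(u+h+\lambda v)-I(u+h)}{\lambda},$$ and the generalized gradient is $\partial I(u)=\{\mu\in X^*:\langle\mu,v\rangle\le I^0(u;v)\ \text{for all } v\in X\}$. A function $g:\mathbb{R}\to\mathbb{R}$ is strictly differentiable at $t$ with derivative $g'(t)$ if $\lim_{s\to t,\ \lambda\to0^+}\frac{g(s+\lambda r)-g(s)}{\lambda}=g'(t)r$ for every $r\in\mathbb{R}$, the convergence being uniform for $r$ in compact sets. Here $g'(f(u))\,\partial f(u)=\{g'(f(u))\,\xi:\xi\in\partial f(u)\}$. *)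

(* Defs.v *)
From HB Require Import structures.
From mathcomp Require Import all_boot all_order all_algebra.
From mathcomp Require Import all_classical all_reals all_analysis.

Set Implicit Arguments.
Unset Strict Implicit.
Unset Printing Implicit Defensive.

Import Order.TTheory GRing.Theory Num.Theory.
Import numFieldNormedType.Exports.

Local Open Scope classical_set_scope.
Local Open Scope ring_scope.

Section ClarkeGradient.
Variables (R : realType) (X : normedModType R).
Implicit Types (I : X -> R) (u v : X).

Definition lipschitz_near I u :=
  exists2 U : set X, nbhs u U & [lipschitz (I x : R^o) | x in U].

(* The increment h may be 0 (full neighborhood filter of 0), whereas lambda
   is positive. The upper limit is extended-real valued so that it is
   meaningful for every I; it is finite when I is Lipschitz near u. *)
Definition gen_dderive I u v : \bar R :=
  limf_esup
    (fun p : X * R => ((I (u + p.1 + p.2 *: v) - I (u + p.1)) / p.2)%:E)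
    (filter_prod (nbhs (0 : X)) (0 : R)^'+).

(* The dual X^* consists of the linear forms X -> R^o that are continuous. *)
Definition gen_gradient I u : set {linear X -> R^o} :=
  [set mu | continuous mu /\
            forall v, ((mu v : R)%:E <= gen_dderive I u v)%E].

End ClarkeGradient.

(* The difference quotients, as functions of r, converge to r |-> d * r
   uniformly on each compact set of r's; since singletons are compact, this
   includes the convergence for every r. *)
Definition is_strict_derive (R : realType) (g : R -> R) (t d : R) :=
  {family compact,
     (fun p : R * R => fun r : R => (g (p.1 + p.2 * r) - g p.1) / p.2)
       @ filter_prod (nbhs t) (0 : R)^'+ --> (fun r : R => d * r)}.

(* Main.v *)
From HB Require Import structures.
Require Import Defs.
From mathcomp Require Import all_boot all_order all_algebra.
From mathcomp Require Import all_classical all_reals all_analysis.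
From mathcomp Require Import lra.
Import Order.TTheory GRing.Theory Num.Theory.
Import numFieldNormedType.Exports.
Local Open Scope classical_set_scope.
Local Open Scope ring_scope.

(** Write d for the strict derivative of g at f u, F for g \o f, and f0, F0 for
    the generalized directional derivatives at u.

    Strict differentiability says that g s' - g s = d (s' - s) up to an error
    e |s' - s|, for any e > 0 and all s, s' close to f u (strict_derive_near).
    Since f is Lipschitz near u, F x - F y = d (f x - f y) up to an arbitrarily
    small multiple of the norm of x - y (comp_strict_near). Hence F is
    Lipschitz near u, and the difference quotients of F are asymptotically d
    times those of f. As the upper limit runs over all base points near u, a
    negative factor can be absorbed by reversing the segment, so
    F0 (v) <= |d| f0 (sgn d v) (gen_dderive_comp_le).

    Let z be in the gradient of F. If d <> 0, applying this bound to sgn d v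
    yields z v / d <= f0 (v), so z / d is in the gradient of f. If d = 0, then
    z v <= 0 for every v, so z = 0 = d xi for any xi in the gradient of f. Such
    a xi exists (gen_gradient_neq0) because f0 is finite and sublinear
    (gen_dderive_sublinear), so that it dominates a linear form (Hahn_Banach),
    which is continuous because f0 is at most a multiple of the norm. *)

(** * Linear forms dominated by a sublinear function *)

Section HahnBanach.
Context {R : realType} {X : lmodType R}.
Implicit Types (p q : X -> R) (x y : X) (s t : R).

(** Only the inequality p (t x) <= t p x is demanded, for t > 0: this is the
    form that passes to infima, and equality follows (sublinearZ). *)
Definition sublinear p :=
  (forall x y, p (x + y) <= p x + p y) /\
  (forall t x, 0 < t -> p (t *: x) <= t * p x).

Lemma sublinear0 p : sublinear p -> p 0 = 0.
Proof.
move=> [_ pZ]; have := pZ 2 0 (ltr0Sn _ 1); have := pZ 2^-1 0.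
rewrite !scaler0 invr_gt0 => /(_ (ltr0Sn _ 1)); lra.
Qed.

Lemma sublinearN p x : sublinear p -> - p (- x) <= p x.
Proof.
move=> ps; have := ps.1 x (- x); rewrite subrr sublinear0//; lra.
Qed.

Lemma sublinearZ p t x : sublinear p -> 0 <= t -> p (t *: x) = t * p x.
Proof.
move=> ps; rewrite le_eqVlt => /predU1P[<-|t0].
  by rewrite scale0r mul0r sublinear0.
apply/eqP; rewrite eq_le ps.2//=.
have := ps.2 t^-1 (t *: x); rewrite scalerA mulVf ?gt_eqF// scale1r invr_gt0.
by move=> /(_ t0); rewrite ler_pdivlMl.
Qed.

(** The two ways of forming infima used below, over a chain of sublinear
    functions and over the functions x |-> q (x + t y) - t q y for t >= 0, both
    satisfy these closure conditions, although the functions of the second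
    family need not be sublinear one by one. *)
Lemma sublinear_inf (A : X -> set R) :
    (forall x, A x !=set0) -> (forall x, has_lbound (A x)) ->
    (forall x y a b, A x a -> A y b -> exists2 c, A (x + y) c & c <= a + b) ->
    (forall t x a, 0 < t -> A x a -> exists2 c, A (t *: x) c & c <= t * a) ->
  sublinear (fun x => inf (A x)).
Proof.
move=> A0 Alb AD AZ; split=> [x y|t x t0].
- apply/ler_addgt0Pr => e e0.
  have e2 : 0 < e / 2 by rewrite divr_gt0.
  have [a Aa ae] := inf_adherent e2 (conj (A0 x) (Alb x)).
  have [b Ab be] := inf_adherent e2 (conj (A0 y) (Alb y)).
  have [c Ac cab] := AD _ _ _ _ Aa Ab.
  have := ge_inf (Alb _) Ac; lra.
- rewrite -ler_pdivrMl//; apply: lb_le_inf => // a Aa.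
  have [c Ac cta] := AZ _ _ _ t0 Aa.
  by rewrite ler_pdivrMl// (le_trans (ge_inf (Alb _) Ac)).
Qed.

(** The pointwise infimum of a chain is finite because q x >= - q (- x), hence
    q x >= - p (- x), for every q in the chain. It is subadditive because, of
    two members of the chain, the smaller one bounds both the value at x and
    the value at y. *)
Lemma inf_chain_sublinear p (S : set (X -> R)) :
    S !=set0 -> (forall q, S q -> sublinear q /\ forall x, q x <= p x) ->
    total_on S (fun q1 q2 => forall x, q2 x <= q1 x) ->
  exists q0, [/\ sublinear q0, forall x, q0 x <= p x
    & forall q, S q -> forall x, q0 x <= q x].
Proof.
move=> [q1 Sq1] Sp Stot; pose A x := [set q x | q in S].
have Alb x : has_lbound (A x).
  exists (- p (- x)) => _ [q Sq <-]; have [qs qp] := Sp _ Sq.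
  have := sublinearN q x qs; have := qp (- x); lra.
have inf_le q x : S q -> inf (A x) <= q x.
  by move=> Sq; apply: ge_inf => //; exists q.
exists (fun x => inf (A x)); split=> [|x|q Sq x]; last exact: inf_le.
- apply: sublinear_inf => // [x|x y _ _ [q Sq <-] [r Sr <-]|t x _ t0 [q Sq <-]].
  + by exists (q1 x), q1.
  + have [qr|rq] := Stot _ _ Sq Sr.
      exists (r (x + y)); first by exists r.
      by rewrite (le_trans ((Sp _ Sr).1.1 _ _))// lerD2r.
    exists (q (x + y)); first by exists q.
    by rewrite (le_trans ((Sp _ Sq).1.1 _ _))// lerD2l.
  + by exists (q (t *: x)); [exists q|exact: (Sp _ Sq).1.2].
- exact: le_trans (inf_le _ _ Sq1) ((Sp _ Sq1).2 x).
Qed.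

(** The function r x = inf over t >= 0 of q (x + t y) - t q y is sublinear and
    lies below q (take t = 0), so it equals q if q is minimal; but
    r (- y) <= - q y (take t = 1). *)
Lemma minimal_sublinearN q :
    sublinear q ->
    (forall r, sublinear r -> (forall x, r x <= q x) -> r = q) ->
  forall y, q (- y) = - q y.
Proof.
move=> qs qmin y.
pose A x := [set q (x + t *: y) - t * q y | t in [set t : R | 0 <= t]].
have Alb x : has_lbound (A x).
  exists (- q (- x)) => _ [t /= t0 <-]; rewrite -sublinearZ//.
  have := qs.1 (x + t *: y) (- x); rewrite addrAC subrr add0r; lra.
have inf_le x t : 0 <= t -> inf (A x) <= q (x + t *: y) - t * q y.
  by move=> t0; apply: ge_inf => //; exists t.
have rs : sublinear (fun x => inf (A x)).
  apply: sublinear_inf => //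
      [x|x1 x2 _ _ [t1 /= t10 <-] [t2 /= t20 <-]|t x _ t0 [s /= s0 <-]].
  - by exists (q (x + 0 *: y) - 0 * q y), 0 => //=.
  - eexists; first by exists (t1 + t2) => //=; exact: addr_ge0.
    have := qs.1 (x1 + t1 *: y) (x2 + t2 *: y).
    by rewrite addrACA -scalerDl; lra.
  - eexists; first by exists (t * s) => //=; rewrite mulr_ge0// ltW.
    by rewrite -scalerA -scalerDr sublinearZ ?(ltW t0)// mulrBr mulrA.
have rq x : inf (A x) <= q x.
  by have := inf_le x 0 (lexx _); rewrite scale0r addr0 mul0r subr0.
have rE := qmin _ rs rq.
have := inf_le (- y) 1 ler01; rewrite scale1r addNr (sublinear0 q)// mul1r.
rewrite -[inf _]/((fun x => inf (A x)) (- y)) rE => qyN.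
have := sublinearN q (- y) qs; rewrite opprK; lra.
Qed.

(** Zorn's lemma gives a minimal sublinear function below p. It is odd, and an
    odd subadditive function is additive: q x <= q (x + y) + q (- y). *)
Theorem Hahn_Banach p : sublinear p ->
  exists mu : {linear X -> R^o}, forall x, mu x <= p x.
Proof.
move=> ps.
pose T := {q : X -> R | sublinear q /\ forall x, q x <= p x}.
(* The order is reversed: a maximal element is a minimal function. *)
pose le_T (q1 q2 : T) := `[< forall x, sval q2 x <= sval q1 x >].
have [|q1 q2 q3 /asboolP q12 /asboolP q23|||[q [qs qp]] qmax] :=
    @Zorn T le_T.
- by move=> q; apply/asboolP.
- by apply/asboolP => x; exact: le_trans (q23 x) (q12 x).
- move=> [q1 Hq1] [q2 Hq2] /asboolP /= q12 /asboolP /= q21; apply: eq_exist.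
  apply/funext => x.
  by apply/eqP; rewrite eq_le q12 q21.
- move=> C Ctot; have [[q1 Cq1]|C0] := pselect (C !=set0); last first.
    exists (exist _ p (conj ps (fun x => lexx (p x)))) => q Cq.
    by case: C0; exists q.
  have [|q [q' _ <-]|q r [q' Cq <-] [r' Cr <-]|q0 [q0s q0p q0C]] :=
      @inf_chain_sublinear p [set sval q | q in C].
  + by exists (sval q1), q1.
  + exact: (svalP q').
  + by case: (Ctot _ _ Cq Cr) => /asboolP; [left|right].
  + exists (exist _ q0 (conj q0s q0p)) => q Cq; apply/asboolP => x.
    by apply: q0C; exists q.
have qmin r : sublinear r -> (forall x, r x <= q x) -> r = q.
  move=> rs rq.
  have rp x : r x <= p x := le_trans (rq x) (qp x).
  exact: (congr1 sval (qmax (exist _ r (conj rs rp)) (asboolT rq))).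
have qN := minimal_sublinearN q qs qmin.
have qD x y : q (x + y) = q x + q y.
  apply/eqP; rewrite eq_le qs.1/=.
  have := qs.1 (x + y) (- y); rewrite qN addrK; lra.
have qlin : linear (q : X -> R^o).
  move=> t x y; rewrite qD; congr (_ + _).
  have [t0|/ltW t0] := leP 0 t; first exact: sublinearZ.
  by rewrite -[t in LHS]opprK scaleNr qN sublinearZ ?oppr_ge0// mulNr opprK.
pose mu := HB.pack_for {linear X -> R^o} (q : X -> R^o)
  (GRing.isLinear.Build _ _ _ _ _ qlin).
by exists mu.
Qed.

End HahnBanach.

(** * Difference quotients and their upper limit *)

Section LimsupReal.
Context {R : realType} {T0 : choiceType} {T : filteredType T0}
  {F : set_system T} {FF : ProperFilter F}.
Implicit Types (q : T -> R) (b : R).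

Lemma limf_esup_lt_near q b :
  (limf_esup (EFin \o q) F < b%:E)%E -> \forall p \near F, q p < b.
Proof.
move=> /ereal_inf_lt[_ [A FA <-] Ab]; apply: filterS FA => p Ap.
rewrite -lte_fin (le_lt_trans _ Ab)//.
by apply: ereal_sup_ubound; exists p.
Qed.

Lemma limf_esup_le_near q b :
  (\forall p \near F, q p <= b) -> (limf_esup (EFin \o q) F <= b%:E)%E.
Proof.
move=> qb; pose A := [set p | q p <= b].
apply: (@le_trans _ _ (ereal_sup ((EFin \o q) @` A))).
  by apply: ereal_inf_lbound; exists A.
by apply: ge_ereal_sup => _ [p pb <-]; rewrite lee_fin.
Qed.

Lemma limf_esup_ge_near q b :
  (\forall p \near F, b <= q p) -> (b%:E <= limf_esup (EFin \o q) F)%E.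
Proof.
move=> bq; apply: le_ereal_inf_tmp => _ [A FA <-].
have [p [Ap bp]] := filter_ex (filterI FA bq).
apply: (@le_trans _ _ (q p)%:E); first by rewrite lee_fin.
by apply: ereal_sup_ubound; exists p.
Qed.

End LimsupReal.

(** Real upper bounds are all that the lemmas on limf_esup provide; this turns
    them into inequalities between extended reals. *)
Lemma lee_gtP {R : realType} (x y : \bar R) :
  (forall b : R, (y < b%:E)%E -> (x <= b%:E)%E) -> (x <= y)%E.
Proof.
case: y => [r| |] H; last 2 first.
- by rewrite leey.
- rewrite leeNy_eq; apply/eqP; case: x H => [r H| H|//].
    by have := H (r - 1)%R (ltNyr _); rewrite lee_fin lerDl oppr_ge0 ler10.
  by have := H 0%R (ltNyr _).
- by apply/lee_addgt0Pr => e e0; apply: H; rewrite lte_fin ltrDl.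
Qed.

Section DiffQuotient.
Context {R : realType} {X : normedModType R}.
Implicit Types (I : X -> R) (u v : X).

Definition diffq I u v (p : X * R) : R :=
  (I (u + p.1 + p.2 *: v) - I (u + p.1)) / p.2.

Local Notation D := (filter_prod (nbhs (0 : X)) (0 : R)^'+).

Lemma gen_dderiveE I u v :
  gen_dderive I u v = limf_esup (EFin \o diffq I u v) D.
Proof. by []. Qed.

Lemma near_increment_gt0 : \forall p \near D, 0 < p.2.
Proof. have := nbhs_right_gt (0 : R); exact: cvg_snd. Qed.

(** The upper limit defining gen_dderive is taken over all base points u + h
    with h near 0, so it does not see a change of the base point by an amount
    that vanishes with the step, nor a rescaling of the step. Sublinearity of
    the derivative and its behaviour under v |-> - v rest on these two changes
    of variables. *)
Lemma cvg_increment_scale (t : R) : 0 < t -> (p.1, t * p.2) @[p --> D] --> D.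
Proof.
move=> t0; apply: (@cvg_pair _ _ _ D (nbhs (0 : X)) (0 : R)^'+).
  exact: cvg_fst.
apply: (cvg_comp (@snd X R) (fun l : R => t * l) cvg_snd) => A A0.
have t_cvg : t * l @[l --> (0 : R)^'+] --> (0 : R).
  apply: cvg_at_right_filter; rewrite -[X in _ --> X](mulr0 t).
  exact: (cvgM (cvg_cst t) cvg_id).
have := t_cvg _ A0; apply: filterS2 (nbhs_right_gt 0) => l l0; apply.
by rewrite mulr_gt0.
Qed.

Lemma cvg_increment_shift v : (p.1 + p.2 *: v, p.2) @[p --> D] --> D.
Proof.
have snd0 : p.2 @[p --> D] --> (0 : R).
  exact: (cvg_trans cvg_snd (cvg_within _)).
have : p.1 + p.2 *: v @[p --> D] --> 0 + 0 *: v.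
  apply: cvgD; [exact: cvg_fst|].
  exact: (@cvgZr_tmp R X _ D _ (fun p : X * R => p.2) 0 v snd0).
rewrite scale0r addr0 => shift0.
by apply: (@cvg_pair _ _ _ D (nbhs (0 : X)) (0 : R)^'+) => //; exact: cvg_snd.
Qed.

Lemma near_base_point (U : set X) u : nbhs u U ->
  \forall p \near D, U (u + p.1).
Proof.
move=> uU; suff : u + p.1 @[p --> D] --> u by apply.
rewrite -[X in _ --> X](addr0 u); apply: cvgD; first exact: cvg_cst.
exact: cvg_fst.
Qed.

Lemma near_end_point (U : set X) u v : nbhs u U ->
  \forall p \near D, U (u + p.1 + p.2 *: v).
Proof.
move=> uU; have : \forall p \near D, U (u + (p.1 + p.2 *: v)).
  exact: (cvg_increment_shift v _ (near_base_point U u uU)).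
by apply: filterS => p; rewrite addrA.
Qed.
End DiffQuotient.

(** * The generalized gradient of a locally Lipschitz function *)

Section LipschitzGradient.
Context {R : realType} {X : normedModType R}.
Implicit Types (I : X -> R) (u v w : X).
Local Notation D := (filter_prod (nbhs (0 : X)) (0 : R)^'+).

Lemma lipschitz_nearP I u : lipschitz_near I u ->
  exists2 U, nbhs u U & exists2 L : R, 0 <= L &
    forall x y, U x -> U y -> `|I x - I y| <= L * `|x - y|.
Proof.
move=> [U uU [M [Mreal MI]]]; exists U => //.
exists (`|M| + 1) => [|x y Ux Uy]; first by rewrite addr_ge0.
have ML : M < `|M| + 1 by rewrite (le_lt_trans (ler_norm M))// ltrDl.
exact: (MI _ ML (x, y)).
Qed.

Lemma lipschitz_nearI I u (U : set X) (L : R) : nbhs u U ->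
    (forall x y, U x -> U y -> `|I x - I y| <= L * `|x - y|) ->
  lipschitz_near I u.
Proof.
move=> uU IL; exists U => //; exists L; split; first exact: num_real.
move=> M LM [x y] [/= Ux Uy]; rewrite (le_trans (IL _ _ Ux Uy))//.
by rewrite ler_wpM2r// ltW.
Qed.

Lemma lipschitz_diffq_bounded I u : lipschitz_near I u ->
  exists2 L : R, 0 <= L &
    forall v, \forall p \near D, `|diffq I u v p| <= L * `|v|.
Proof.
move=> /lipschitz_nearP[U uU [L L0 IL]]; exists L => // v.
near=> p; have p0 : 0 < p.2 by near: p; exact: near_increment_gt0.
rewrite /diffq normrM normfV (gtr0_norm p0) ler_pdivrMr//.
apply: (le_trans (IL _ _ _ _)).
- by near: p; exact: near_end_point.
- by near: p; exact: near_base_point.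
- by rewrite addrAC subrr add0r normrZ (gtr0_norm p0) mulrA mulrAC.
Unshelve. all: by end_near. Qed.

Lemma gen_dderive_bounded I u : lipschitz_near I u ->
  exists2 L : R, 0 <= L & forall v,
    ((- (L * `|v|))%:E <= gen_dderive I u v <= (L * `|v|)%:E)%E.
Proof.
move=> /lipschitz_diffq_bounded[L L0 IL]; exists L => // v; apply/andP; split.
  apply: limf_esup_ge_near; apply: filterS (IL v) => p.
  by rewrite ler_norml => /andP[].
apply: limf_esup_le_near; apply: filterS (IL v) => p.
by rewrite ler_norml => /andP[].
Qed.

Lemma gen_dderive_fin I u v : lipschitz_near I u ->
  (fine (gen_dderive I u v))%:E = gen_dderive I u v.
Proof.
move=> /gen_dderive_bounded[L L0 /(_ v)/andP[lI Iu]]; apply: fineK.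
by rewrite fin_real// (lt_le_trans (ltNyr _) lI) (le_lt_trans Iu (ltry _)).
Qed.

(** Subadditivity: a step p.2 in the direction v + w is a step in the direction
    w from u + p.1 followed by one in the direction v from
    u + p.1 + p.2 *: w, a base point that tends to u as well. *)
Lemma gen_dderive_sublinear I u : lipschitz_near I u ->
  sublinear (fun v => fine (gen_dderive I u v)).
Proof.
move=> Ilip; split=> [v w|t v t0].
- rewrite -lee_fin EFinD !gen_dderive_fin//; apply: lee_gtP => b.
  rewrite -(gen_dderive_fin _ _ v)// -(gen_dderive_fin _ _ w)// -EFinD lte_fin.
  move=> pb.
  pose e := (b - (fine (gen_dderive I u v) + fine (gen_dderive I u w))) / 2.
  have e0 : 0 < e by rewrite /e; lra.
  have near_lt x : \forall p \near D,
      diffq I u x p < fine (gen_dderive I u x) + e.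
    apply: limf_esup_lt_near.
    by rewrite -gen_dderiveE -gen_dderive_fin// lte_fin; lra.
  rewrite gen_dderiveE; apply: limf_esup_le_near; near=> p.
  have -> : diffq I u (v + w) p =
      diffq I u v (p.1 + p.2 *: w, p.2) + diffq I u w p.
    rewrite /diffq/= -mulrDl; congr (_ / _).
    by rewrite scalerDr [p.2 *: v + _]addrC !addrA subrK.
  have : diffq I u w p < fine (gen_dderive I u w) + e by near: p.
  have : diffq I u v (p.1 + p.2 *: w, p.2) < fine (gen_dderive I u v) + e.
    by near: p; exact: (cvg_increment_shift w _ (near_lt v)).
  rewrite /e; lra.
- rewrite -lee_fin EFinM !gen_dderive_fin//.
  apply: lee_gtP => b; rewrite -(gen_dderive_fin _ _ v)// -EFinM lte_fin => pb.
  rewrite gen_dderiveE; apply: limf_esup_le_near.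
  have near_lt : \forall p \near D, diffq I u v p < b / t.
    apply: limf_esup_lt_near; rewrite -gen_dderiveE -gen_dderive_fin//.
    by rewrite lte_fin ltr_pdivlMr// mulrC.
  have := cvg_increment_scale t t0 _ near_lt.
  apply: filterS2 near_increment_gt0 => p p0.
  rewrite /diffq/= scalerA [p.2 * t]mulrC invfM mulrA mulrAC.
  by rewrite ltr_pdivlMr// mulfVK ?gt_eqF// => /ltW.
Unshelve. all: by end_near. Qed.

Lemma linear_dominated_continuous (mu : {linear X -> R^o}) (L : R) :
  (forall v, mu v <= L * `|v|) -> continuous mu.
Proof.
move=> muL; apply: bounded_linear_continuous; apply/linear_boundedP.
have absL v : `|mu v| <= L * `|v|.
  by rewrite ler_norml muL andbT lerNl -linearN -(normrN v) muL.
exists L; split=> [|M LM v]; first exact: num_real.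
by rewrite (le_trans (absL v))// ler_wpM2r// ltW.
Qed.

(** Continuity of mu comes for free: the derivative, and with it mu, is at most
    L times the norm. *)
Lemma gen_gradient_dominated I u (mu : {linear X -> R^o}) :
    lipschitz_near I u ->
  (forall v, ((mu v : R)%:E <= gen_dderive I u v)%E) -> gen_gradient I u mu.
Proof.
move=> /gen_dderive_bounded[L L0 IL] muI; split => //.
apply: (linear_dominated_continuous _ L) => v; rewrite -lee_fin.
by rewrite (le_trans (muI v))//; case/andP: (IL v).
Qed.

Lemma gen_gradient_neq0 I u : lipschitz_near I u -> gen_gradient I u !=set0.
Proof.
move=> Ilip; have [mu muI] := Hahn_Banach _ (gen_dderive_sublinear _ _ Ilip).
exists mu; apply: gen_gradient_dominated => // v.
by rewrite -gen_dderive_fin// lee_fin muI.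
Qed.
End LipschitzGradient.

(** * Strict differentiability *)

Lemma strict_derive_uniform {R : realType} (g : R -> R) (t d e : R) :
  is_strict_derive g t d -> 0 < e ->
  \forall p \near filter_prod (nbhs t) (0 : R)^'+, forall r, `|r| <= 1 ->
    `|(g (p.1 + p.2 * r) - g p.1) / p.2 - d * r| < e.
Proof.
move=> /fam_cvgP/(_ `[-1, 1]%classic (@segment_compact _ _ _)) gd e0.
pose N := [set h : R -> R | forall r, `[-1, 1]%classic r -> `|h r - d * r| < e].
have : nbhs ((fun r => d * r) : {uniform` `[-1, 1]%classic -> R}) N.
  apply/uniform_nbhs; exists [set x | ball x.1 e x.2]; split.
    by rewrite -entourage_ballE; exists e.
  by move=> h H r /H; rewrite /ball /= distrC.
move=> /gd; rewrite nbhs_filterE; apply: (@filterS _ _ _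
  ((fun p => fun r => (g (p.1 + p.2 * r) - g p.1) / p.2) @^-1` N)) => p pN r r1.
apply: pN.
by rewrite /= in_itv/= -ler_norml.
Qed.

(** Any two points s <> s' near t are joined by the step `|s' - s| in a
    direction r with `|r| = 1, so the uniformity in r makes the linear
    approximation of g uniform in both points. *)
Lemma strict_derive_near {R : realType} (g : R -> R) (t d e : R) :
  is_strict_derive g t d -> 0 < e ->
  exists2 V : set R, nbhs t V & forall s s', V s -> V s' ->
    `|g s' - g s - d * (s' - s)| <= e * `|s' - s|.
Proof.
move=> gd e0.
have [[V W] [tV [w /= w0 wW]] VW] := strict_derive_uniform _ _ _ _ gd e0.
exists (V `&` ball t (w / 2)).
  by apply: filterI => //; apply: nbhsx_ballx; rewrite divr_gt0.
move=> s s' [Vs ts] [Vs' ts'].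
have [->|ss'] := eqVneq s' s; first by rewrite !subrr mulr0 subr0 normr0 mulr0.
have l0 : 0 < `|s' - s| by rewrite normr_gt0 subr_eq0.
have lw : `|s' - s| < w.
  rewrite (le_lt_trans (ler_distD t _ _))// [ltRHS]splitr ltrD//.
  by rewrite distrC.
pose r := (s' - s) / `|s' - s|.
have r1 : `|r| <= 1 by rewrite normrM normfV normr_id mulfV// gt_eqF.
have lr : `|s' - s| * r = s' - s by rewrite /r mulrC mulfVK// gt_eqF.
have Wl : W `|s' - s| by apply: wW => //=; rewrite sub0r normrN normr_id.
have /(_ r r1)/= := VW (s, `|s' - s|) (conj Vs Wl).
rewrite lr [s + _]addrC subrK => /ltW.
rewrite -(ler_pM2l l0) -{1}[`|s' - s|]normr_id -normrM mulrBr.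
rewrite [X in _ - X]mulrCA lr [X in X - _]mulrC divfK ?gt_eqF//.
by rewrite [_ * e]mulrC.
Qed.

(** * The chain rule *)

Section ChainRule.
Context {R : realType} {X : normedModType R}.
Context (f : X -> R) (g : R -> R) (u : X) (d : R).
Context (f_lip : lipschitz_near f u) (g_sdiff : is_strict_derive g (f u) d).
Local Notation D := (filter_prod (nbhs (0 : X)) (0 : R)^'+).

(** To first order at u, uniformly in pairs of points, g \o f varies like
    d * f: strict differentiability gives an error e * `|f x - f y|, which the
    Lipschitz property of f bounds by a multiple of e * `|x - y|. *)
Lemma comp_strict_near e : 0 < e -> exists2 U, nbhs u U &
  forall x y, U x -> U y ->
    `|g (f x) - g (f y) - d * (f x - f y)| <= e * `|x - y|.
Proof.
move=> e0; have [U uU [L L0 fL]] := lipschitz_nearP _ _ f_lip.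
(* The error is divided by L + 1 because L may be 0. *)
have L1 : 0 < L + 1 by rewrite ltr_wpDl.
have [V fuV gV] := strict_derive_near _ _ _ _ g_sdiff (divr_gt0 e0 L1).
exists (U `&` f @^-1` V) => [|x y [Ux Vx] [Uy Vy]].
  have Uu : U u := nbhs_singleton uU.
  apply: filterI => //; move: fuV => /nbhs_ballP[r /= r0 rV].
  have := nbhsx_ballx u _ (divr_gt0 r0 L1) => ub.
  apply: filterS2 uU ub => x Ux; rewrite -ball_normE/= => ux; apply: rV.
  rewrite -ball_normE/=.
  rewrite (le_lt_trans (fL _ _ Uu Ux))//.
  rewrite (@le_lt_trans _ _ ((L + 1) * `|u - x|))//.
    by rewrite ler_wpM2r// lerDl.
  by rewrite mulrC -ltr_pdivlMr.
rewrite (le_trans (gV _ _ Vy Vx))// (le_trans (ler_wpM2l _ (fL _ _ Ux Uy)))//.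
  by rewrite divr_ge0// ltW.
rewrite mulrA ler_wpM2r// mulrAC ler_pdivrMr// ler_pM2l//.
by rewrite lerDl.
Qed.

Lemma comp_lipschitz_near : lipschitz_near (g \o f) u.
Proof.
have [U uU gf] := comp_strict_near 1 ltr01.
have [V uV [L L0 VL]] := lipschitz_nearP _ _ f_lip.
apply: (@lipschitz_nearI _ _ _ _ (U `&` V) (1 + `|d| * L)).
  exact: filterI.
move=> x y [Ux Vx] [Uy Vy] /=.
rewrite -[X in `|X|](subrK (d * (f x - f y))) (le_trans (ler_normD _ _))//.
rewrite mulrDl lerD ?gf// normrM -mulrA ler_wpM2l//.
exact: VL.
Qed.

Lemma diffq_comp_near v e : 0 < e ->
  \forall p \near D, `|diffq (g \o f) u v p - d * diffq f u v p| <= e.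
Proof.
move=> e0; have v1 : 0 < `|v| + 1 by rewrite ltr_wpDl.
have [U uU gf] := comp_strict_near _ (divr_gt0 e0 v1).
near=> p; have p0 : 0 < p.2 by near: p; exact: near_increment_gt0.
rewrite /diffq mulrA -mulrBl normrM normfV (gtr0_norm p0) ler_pdivrMr//=.
apply: (le_trans (gf _ _ _ _)).
- by near: p; exact: near_end_point.
- by near: p; exact: near_base_point.
- rewrite addrAC subrr add0r normrZ (gtr0_norm p0) mulrCA mulrC.
  rewrite ler_wpM2r ?(ltW p0)//.
  by rewrite mulrAC ler_pdivrMr// ler_pM2l// lerDl.
Unshelve. all: by end_near. Qed.

(** The sign of d goes into the direction. For d < 0 the quotient of - f at
    (h, l) in the direction v is the quotient of f in the direction - v at the
    increment (h + l v, l), where the segment is run backwards. *)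
Lemma scaled_diffq_near v b :
    (gen_dderive f u (Num.sg d *: v) < b%:E)%E ->
  \forall p \near D, d * diffq f u v p <= `|d| * b.
Proof.
rewrite gen_dderiveE => /limf_esup_lt_near.
have [->|d0|d0] := sgrP d.
- by move=> _; apply: nearW => p; rewrite !mul0r.
- rewrite scale1r; apply: filterS => p /ltW.
  by rewrite ler_pM2l.
- rewrite scaleN1r => /(cvg_increment_shift v) qb.
  have : \forall p \near D, diffq f u (- v) (p.1 + p.2 *: v, p.2) < b := qb.
  apply: filterS => p /ltW.
  have -> : diffq f u (- v) (p.1 + p.2 *: v, p.2) = - diffq f u v p.
    by rewrite /diffq/= scalerN !addrA addrK -mulNr opprB.
  by move=> qN; rewrite mulNr -mulrN ler_nM2l// lerNl.
Qed.

Lemma gen_dderive_comp_le v b :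
    (gen_dderive f u (Num.sg d *: v) < b%:E)%E ->
  (gen_dderive (g \o f) u v <= (`|d| * b)%:E)%E.
Proof.
move=> /scaled_diffq_near qb; apply/lee_addgt0Pr => e e0.
rewrite -EFinD gen_dderiveE; apply: limf_esup_le_near.
apply: filterS2 qb (diffq_comp_near v e e0) => p.
rewrite ler_norml => qb /andP[_]; lra.
Qed.

(** If d <> 0, the only candidate for xi is z / d. If d = 0, then z <= 0
    everywhere, so z = 0 and any xi in the gradient of f will do; that there is
    one is where the theorem of Hahn and Banach enters. *)
Lemma gen_gradient_comp (z : {linear X -> R^o}) : gen_gradient (g \o f) u z ->
  exists2 xi : {linear X -> R^o}, gen_gradient f u xi &
    forall v, z v = d * xi v.
Proof.
move=> [_ zF].
have z_le v b : (gen_dderive f u (Num.sg d *: v) < b%:E)%E -> z v <= `|d| * b.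
  by move=> /gen_dderive_comp_le Fb; rewrite -lee_fin (le_trans (zF v)).
have [d0|d0] := eqVneq d 0.
  have z_le0 v : z v <= 0.
    have := z_le v (fine (gen_dderive f u 0) + 1).
    rewrite d0 sgr0 scale0r normr0 mul0r; apply.
    by rewrite -gen_dderive_fin// lte_fin ltrDl.
  have [xi fxi] := gen_gradient_neq0 f u f_lip.
  exists xi => // v; rewrite d0 mul0r; apply/eqP; rewrite eq_le z_le0/=.
  by rewrite -oppr_le0 -linearN z_le0.
exists (d^-1 \*: z); last by move=> v /=; rewrite [RHS]mulVKf.
apply: gen_gradient_dominated => // v; apply: lee_gtP => b fb; rewrite lee_fin.
have sgd : Num.sg d * Num.sg d = 1 by rewrite -expr2 sqr_sg d0.
have := z_le (Num.sg d *: v) b; rewrite scalerA sgd scale1r => /(_ fb).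
rewrite linearZ /= -ler_pdivrMl ?normr_gt0//; congr (_ <= _).
rewrite -[_ *: z v]/(Num.sg d * z v) -[_ *: z v]/(d^-1 * z v) mulrA.
congr (_ * _).
by rewrite -[in RHS](mulr_sg_norm d) invfM invr_sg mulrC.
Qed.
End ChainRule.

Theorem theorem2p1 (R : realType) (X : completeNormedModType R) (u : X)
    (f : X -> R) (g g' : R -> R)
    (f_lip : lipschitz_near f u)
    (g_sdiff : \forall t \near f u, is_strict_derive g t (g' t)) :
  lipschitz_near (g \o f) u /\
  gen_gradient (g \o f) u `<=`
    [set z : {linear X -> R^o} |
      exists2 xi : {linear X -> R^o}, gen_gradient f u xi &
        forall v : X, z v = g' (f u) * xi v].
Proof.
have g_sdiff_fu : is_strict_derive g (f u) (g' (f u)) := nbhs_singleton g_sdiff.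
split; first exact: (comp_lipschitz_near _ _ _ _ f_lip g_sdiff_fu).
by move=> z; exact: gen_gradient_comp.
Qed.
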